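(* Let $U$ be an optimal prefix-free machine and let $f:2^\omega\to[0,1]$, $f(x)=\sum_{\sigma\le_L x}2^{-K_U(\sigma)}$. Then $f(2^\omega)$ is a $\Pi^0_1(\emptyset')$ class. Hence every real in $f(2^\omega)$ is not $\emptyset'$-Kurtz random.
   Context: A machine is a partial computable function $M$ from $2^{<\omega}$ to $2^{<\omega}$; it is prefix-free if its domain is a prefix-free set. $K_M(\sigma)=\min\{|\tau|: M(\tau)=\sigma\}$ ($=\infty$ if there is no such $\tau$, with $2^{-\infty}=0$). A prefix-free machine $U$ is optimal if for each prefix-free machine $M$ there is a constant $c$ with $K_U(\sigma)\le K_M(\sigma)+c$ for all $\sigma$. For $\sigma\in 2^{<\omega}$ and $x\in 2^\omega$, $\sigma<_L x$ means that there is $n$ with $\sigma\upharpoonright n=x\upharpoonright n$, $\sigma(n)=0$ and $x(n)=1$; $\sigma\le_L x$ means that $\sigma<_L x$ or $\sigma$ is an initial segment of $x$. A real is $\emptyset'$-Kurtz random if it is not in any $\Pi^0_1(\emptyset')$ class of Lebesgue measure zero (Kurtz randomness relativized to the halting problem $\emptyset'$). *)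

(* Defs.v *)
From HB Require Import structures.
From Stdlib Require Import Cantor.
From mathcomp Require Import all_boot all_order all_algebra.
From mathcomp Require Import all_classical all_reals all_analysis.
Set Implicit Arguments.
Unset Strict Implicit.
Unset Printing Implicit Defensive.
Import Order.TTheory GRing.Theory Num.Theory.
Local Open Scope classical_set_scope.
Local Open Scope ring_scope.

(* Cantor's pairing bijection and its inverse. *)
Notation pair_nat a b := (Cantor.to_nat (a%N, b%N)).
Notation unpair_nat n := (Cantor.of_nat n).

(* Programs for the partial functions nat -> nat that are recursive relative
   to an oracle. All functions are unary; several arguments are passed through
   the pairing function. *)
Inductive code : Type :=
| Zero
| Succ
| Fst
| Snd
| Oracle
| Pair of code & code
| Comp of code & code
| Rec of code & code
| Mu of code.

(* computes A c x y : with oracle A, the program c halts on x with output y.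
   Rec f g on the input <a, n> is primitive recursion,
     h(a, 0) = f(a),  h(a, i + 1) = g(a, i, h(a, i)),
   where s lists h(a, 0), ..., h(a, n). Mu f on the input x returns the least
   y with f(x, y) = 0, provided that f(x, z) is defined for all z < y. *)
Fixpoint computes (A : set nat) (c : code) (x y : nat) : Prop :=
  match c with
  | Zero => y = 0%N
  | Succ => y = x.+1
  | Fst => y = (unpair_nat x).1
  | Snd => y = (unpair_nat x).2
  | Oracle => y = nat_of_bool `[< A x >]
  | Pair f g =>
      exists a b, [/\ computes A f x a, computes A g x b & y = pair_nat a b]
  | Comp f g => exists z, computes A g x z /\ computes A f z y
  | Rec f g =>
      let: (a, n) := unpair_nat x in
      exists s : nat -> nat,
        [/\ computes A f a (s 0%N),
            forall i, (i < n)%N ->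
              computes A g (pair_nat a (pair_nat i (s i))) (s i.+1)
          & y = s n]
  | Mu f =>
      computes A f (pair_nat x y) 0%N /\
      forall z, (z < y)%N -> exists v, computes A f (pair_nat x z) v.+1
  end.

Fixpoint godel (c : code) : nat :=
  match c with
  | Zero => pair_nat 0 0
  | Succ => pair_nat 1 0
  | Fst => pair_nat 2 0
  | Snd => pair_nat 3 0
  | Oracle => pair_nat 4 0
  | Pair f g => pair_nat 5 (pair_nat (godel f) (godel g))
  | Comp f g => pair_nat 6 (pair_nat (godel f) (godel g))
  | Rec f g => pair_nat 7 (pair_nat (godel f) (godel g))
  | Mu f => pair_nat 8 (godel f)
  end.

Definition halts (A : set nat) (c : code) (x : nat) : Prop :=
  exists y, computes A c x y.

Definition jump (A : set nat) : set nat :=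
  [set e | exists c, godel c = e /\ halts A c e].

Definition halting_problem : set nat := jump set0.

Definition ce_in (A W : set nat) : Prop :=
  exists c, W = [set n | halts A c n].

(* The position of s in the length-lexicographic enumeration of binary strings,
   i.e. the number with binary expansion 1s, minus one; this is a bijection. *)
Definition string_code (s : seq bool) : nat :=
  (foldl (fun n (b : bool) => n.*2 + b)%N 1%N s).-1.

(* M s = None means that M is undefined at s. *)
Definition partial_computable (M : seq bool -> option (seq bool)) : Prop :=
  exists c, forall t s,
    M t = Some s <-> computes set0 c (string_code t) (string_code s).

Definition prefix_free (D : set (seq bool)) : Prop :=
  forall s t, D s -> D t -> prefix s t -> s = t.

Definition prefix_free_machine (M : seq bool -> option (seq bool)) : Prop :=
  partial_computable M /\ prefix_free [set t | M t != None].

(* K M s is the length of a shortest M-description of s; None stands for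
   infinity. *)
Definition K (M : seq bool -> option (seq bool)) (s : seq bool) : option nat :=
  let described n := `[< exists t, size t = n /\ M t = Some s >] in
  if pselect (exists n, described n) is left ex then Some (ex_minn ex)
  else None.

Definition le_infty (a b : option nat) : Prop :=
  match a, b with
  | _, None => True
  | None, Some _ => False
  | Some i, Some j => (i <= j)%N
  end.

Definition optimal (U : seq bool -> option (seq bool)) : Prop :=
  prefix_free_machine U /\
  forall M, prefix_free_machine M ->
    exists c : nat, forall s, le_infty (K U s) (omap (addn c) (K M s)).

Definition lt_left (s : seq bool) (x : nat -> bool) : Prop :=
  exists n, [/\ (n < size s)%N, take n s = mkseq x n,
                nth false s n = false & x n = true].

Definition le_left (s : seq bool) (x : nat -> bool) : Prop :=
  lt_left s x \/ s = mkseq x (size s).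

Definition weight (R : realType) (k : option nat) : R :=
  if k is Some n then 2 ^- n else 0.

(* The sum is taken in the extended reals,
   where it always exists. *)
Definition left_weight (R : realType) (U : seq bool -> option (seq bool))
    (x : nat -> bool) : \bar R :=
  \esum_(s in [set s | le_left s x]) (weight R (K U s))%:E.

Definition left_weight_image (R : realType)
    (U : seq bool -> option (seq bool)) : set R :=
  [set r | exists x, left_weight R U x = r%:E].

Arguments left_weight_image : clear implicits.

(* n = <<i, j>, d> codes the rational (i - j) / (d + 1). *)
Definition rational (R : realType) (n : nat) : R :=
  let: (m, d) := unpair_nat n in
  let: (i, j) := unpair_nat m in
  (i%:R - j%:R) / d.+1%:R.

Definition rational_interval (R : realType) (n : nat) : set R :=
  let: (a, b) := unpair_nat n in
  [set r | rational R a < r < rational R b].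

Arguments rational_interval : clear implicits.

(* The complements of the open sets generated by an A-c.e. set of rational
   open intervals. *)
Definition Pi01_class (R : realType) (A : set nat) (P : set R) : Prop :=
  exists W, ce_in A W /\ P = ~` \bigcup_(n in W) rational_interval R n.

Definition kurtz_random (R : realType) (A : set nat) (r : R) : Prop :=
  forall P : set R, Pi01_class A P ->
    lebesgue_measure (P : set (measurableTypeR R)) = 0%E -> ~ P r.

(* Main.v *)
Require Import Defs.
From Stdlib Require Import Cantor.
From mathcomp Require Import all_boot all_order all_algebra.
From mathcomp Require Import all_classical all_reals all_analysis.
From mathcomp Require Import zify lra.
Set Implicit Arguments.
Unset Strict Implicit.
Unset Printing Implicit Defensive.
Import Order.TTheory GRing.Theory Num.Theory.
Import numFieldNormedType.Exports.
Local Open Scope classical_set_scope.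
Local Open Scope ring_scope.

(** The function f is the distribution function of an atomic measure. Read a
    string t of length l as the dyadic rational 0.t and give it the mass
    2^(-K(t)); by Kraft's inequality the total mass is at most 1. If v(N) is
    the integer with binary expansion x(0) ... x(N-1), then t lies to the left
    of x exactly when its binary value is at most v(l)
    ([le_left_prefix_val]). So for a dyadic p = i / 2^N, the set of strings
    left of x either is contained in {t : 0.t < p} or contains
    {t : 0.t <= p} ([left_of_below], [upto_left_of]), and f(x) never enters
    the gap between the masses of these two sets. Conversely a real r outside
    all gaps is a value of f ([value_of_not_in_gap]): at each level N, take
    the largest i < 2^N for which the mass of {t : 0.t <= i/2^N} is at most r;
    then r is at most the mass of {t : 0.t < (i+1)/2^N}, these i are the
    prefixes of one sequence x, and the two masses differ by at most the mass
    of the strings longer than N, which tends to 0. Hence the image of f is the complement of the gaps.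

    The same intervals show that the image is null ([range_value_measure0]):
    at level N they cover the image, and their lengths add up to at most the
    mass of the strings longer than N, because the open intervals
    i/2^N < q < (i+1)/2^N are disjoint and contain 0.t only if t is longer
    than N.

    It remains to enumerate the gaps relative to the halting problem. The mass
    of a set of strings that is decidable is the limit from below of a
    computable sequence of rationals, obtained by running the machine for k
    steps on the first k inputs ([mass_num_le], [lt_mass_num]). A rational
    interval (a, b) lies in the gap of p when some stage k witnesses
    b <= mass{0.t <= p} and all stages j satisfy
    stage_j{0.t < p} <= a. This is a condition of the form
    exists u, forall j, R with R decidable, and such conditions are c.e. in
    the halting problem ([ce_in_halting_problem]): search for u and ask the
    oracle whether the search for a counterexample j halts. *)

(** * Recursive functions *)

Arguments Cantor.to_nat : simpl never.
Arguments Cantor.of_nat : simpl never.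

Local Notation proj1 n := (Cantor.of_nat n).1.
Local Notation proj2 n := (Cantor.of_nat n).2.

Local Open Scope nat_scope.

Lemma proj1_pair a b : proj1 (pair_nat a b) = a.
Proof. by rewrite Cantor.cancel_of_to. Qed.

Lemma proj2_pair a b : proj2 (pair_nat a b) = b.
Proof. by rewrite Cantor.cancel_of_to. Qed.

Lemma pair_proj n : pair_nat (proj1 n) (proj2 n) = n.
Proof. by rewrite -[RHS]Cantor.cancel_to_of; case: Cantor.of_nat. Qed.

Definition projE := (proj1_pair, proj2_pair, pair_proj).

(** One program serves for all oracles, so that recursive functions can be
    used both in oracle-free searches and in searches relative to the halting
    problem. Functions of several variables are stated in the form
    f (u x) (v x), where x codes all variables in scope; the closure lemmas
    below then apply to bodies as they stand. *)
Definition recursive (f : nat -> nat) : Prop :=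
  exists c, forall A x, computes A c x (f x).

Lemma recursive_ext f g : f =1 g -> recursive f -> recursive g.
Proof. by move=> fg [c hc]; exists c => A x; rewrite -fg. Qed.

Lemma recursive_comp f g : recursive f -> recursive g -> recursive (f \o g).
Proof. by move=> [c hc] [d hd]; exists (Comp c d) => A x /=; exists (g x). Qed.

Lemma recursive_S f : recursive f -> recursive (fun x => (f x).+1).
Proof. by move=> hf; apply: (recursive_comp (f := S)) => //; exists Succ. Qed.

Lemma recursive_proj1 f : recursive f -> recursive (fun x => proj1 (f x)).
Proof.
by move=> hf; apply: (recursive_comp (f := fun n => proj1 n)) => //; exists Fst.
Qed.

Lemma recursive_proj2 f : recursive f -> recursive (fun x => proj2 (f x)).
Proof.
by move=> hf; apply: (recursive_comp (f := fun n => proj2 n)) => //; exists Snd.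
Qed.

Lemma recursive_pair f g : recursive f -> recursive g ->
  recursive (fun x => pair_nat (f x) (g x)).
Proof.
by move=> [c hc] [d hd]; exists (Pair c d) => A x /=; exists (f x), (g x).
Qed.

Lemma recursive_id : recursive id.
Proof.
exists (Pair Fst Snd) => A x /=; exists (proj1 x), (proj2 x).
by split=> //; rewrite pair_proj.
Qed.

Lemma recursive_const n : recursive (fun=> n).
Proof. by elim: n => [|n IH]; [exists Zero | exact: recursive_S]. Qed.

(** In the step function h, the variables are the outer context x, the
    counter i and the previous value s. *)
Lemma recursive_rec a n (h : nat -> nat -> nat -> nat) :
  recursive a -> recursive n ->
  recursive (fun z => h (proj1 z) (proj1 (proj2 z)) (proj2 (proj2 z))) ->
  recursive (fun x => nat_rect (fun=> nat) (a x) (h x) (n x)).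
Proof.
move=> [ca hca] hn [ch hch].
suff : recursive (fun z => nat_rect (fun=> nat) (a (proj1 z)) (h (proj1 z))
                             (proj2 z)).
  move=> H; have := recursive_comp H (recursive_pair recursive_id hn).
  by apply: recursive_ext => x /=; rewrite !projE.
exists (Rec ca ch) => A z /=; case: Cantor.of_nat => x m /=.
exists (fun i => nat_rect (fun=> nat) (a x) (h x) i); split=> // i _ /=.
by have := hch A (pair_nat x (pair_nat i
  (nat_rect (fun=> nat) (a x) (h x) i))); rewrite !projE.
Qed.

Lemma recursive_pred f : recursive f -> recursive (fun x => (f x).-1).
Proof.
move=> hf; apply: (@recursive_ext (fun x =>
  nat_rect (fun=> nat) 0 (fun i s => i) (f x))); first by move=> x; case: (f x).
apply: (recursive_rec (h := fun x i s => i)) => //.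
  exact: recursive_const.
by apply: recursive_proj1; apply: recursive_proj2; exact: recursive_id.
Qed.

Lemma recursive_add f g : recursive f -> recursive g ->
  recursive (fun x => f x + g x).
Proof.
move=> hf hg; apply: (@recursive_ext (fun x =>
  nat_rect (fun=> nat) (f x) (fun i s => s.+1) (g x))).
  by move=> x; elim: (g x) => [|m /= ->]; rewrite ?addn0 ?addnS.
apply: (recursive_rec (h := fun x i s => s.+1)) => //.
by apply: recursive_S; do 2!apply: recursive_proj2; exact: recursive_id.
Qed.

Lemma recursive_sub f g : recursive f -> recursive g ->
  recursive (fun x => f x - g x).
Proof.
move=> hf hg; apply: (@recursive_ext (fun x =>
  nat_rect (fun=> nat) (f x) (fun i s => s.-1) (g x))).
  by move=> x; elim: (g x) => [|m /= ->]; rewrite ?subn0 ?subnS.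
apply: (recursive_rec (h := fun x i s => s.-1)) => //.
by apply: recursive_pred; do 2!apply: recursive_proj2; exact: recursive_id.
Qed.

(** The body lives in the context that codes the outer context x together with
    the bounded variable i. *)
Lemma recursive_sum (F : nat -> nat -> nat) n : recursive n ->
  recursive (fun z => F (proj1 z) (proj2 z)) ->
  recursive (fun x => \sum_(i < n x) F x i).
Proof.
move=> hn hF; apply: (@recursive_ext (fun x =>
  nat_rect (fun=> nat) 0 (fun i s => s + F x i) (n x))).
  move=> x; elim: (n x) => [|m /= ->]; first by rewrite big_ord0.
  by rewrite big_ord_recr.
apply: (recursive_rec (h := fun x i s => s + F x i)) => //.
  exact: recursive_const.
apply: recursive_add; first by do 2!apply: recursive_proj2; exact: recursive_id.
have h : recursive (fun z => pair_nat (proj1 z) (proj1 (proj2 z))).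
  apply: recursive_pair; first by apply: recursive_proj1; exact: recursive_id.
  by apply: recursive_proj1; apply: recursive_proj2; exact: recursive_id.
by apply: recursive_ext (recursive_comp hF h) => z /=; rewrite !projE.
Qed.

Lemma recursive_max (F : nat -> nat -> nat) n : recursive n ->
  recursive (fun z => F (proj1 z) (proj2 z)) ->
  recursive (fun x => \max_(i < n x) F x i).
Proof.
move=> hn hF; apply: (@recursive_ext (fun x =>
  nat_rect (fun=> nat) 0 (fun i s => s + (F x i - s)) (n x))).
  move=> x; elim: (n x) => [|m /= ->]; first by rewrite big_ord0.
  by rewrite big_ord_recr /= maxnE.
apply: (recursive_rec (h := fun x i s => s + (F x i - s))) => //.
  exact: recursive_const.
have hs : recursive (fun z => proj2 (proj2 z)).
  by do 2!apply: recursive_proj2; exact: recursive_id.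
apply: recursive_add => //; apply: recursive_sub => //.
have h : recursive (fun z => pair_nat (proj1 z) (proj1 (proj2 z))).
  apply: recursive_pair; first by apply: recursive_proj1; exact: recursive_id.
  by apply: recursive_proj1; apply: recursive_proj2; exact: recursive_id.
by apply: recursive_ext (recursive_comp hF h) => z /=; rewrite !projE.
Qed.

Lemma recursive_mul f g : recursive f -> recursive g ->
  recursive (fun x => f x * g x).
Proof.
move=> hf hg; apply: (@recursive_ext (fun x => \sum_(i < g x) f x)).
  by move=> x; rewrite sum_nat_const card_ord mulnC.
apply: (recursive_sum (F := fun x i => f x)) => //.
apply: (recursive_comp hf); apply: recursive_proj1; exact: recursive_id.
Qed.

Lemma recursive_pow2 f : recursive f -> recursive (fun x => 2 ^ f x).
Proof.
move=> hf; apply: (@recursive_ext (fun x =>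
  nat_rect (fun=> nat) 1 (fun i s => s + s) (f x))).
  by move=> x; elim: (f x) => [|m /= ->] //; rewrite expnS mul2n addnn.
apply: (recursive_rec (h := fun x i s => s + s)) => //.
  exact: recursive_const.
by apply: recursive_add; do 2!apply: recursive_proj2; exact: recursive_id.
Qed.

Definition rec_decidable (P : nat -> bool) : Prop := recursive (fun x => P x).

Lemma decidable_neg P : rec_decidable P -> rec_decidable (fun x => ~~ P x).
Proof.
move=> hP; apply: (@recursive_ext (fun x => 1 - P x)).
  by move=> x; case: (P x).
by apply: recursive_sub => //; exact: recursive_const.
Qed.

Lemma decidable_and P Q : rec_decidable P -> rec_decidable Q ->
  rec_decidable (fun x => P x && Q x).
Proof.
move=> hP hQ; apply: (@recursive_ext (fun x => P x * Q x)).
  by move=> x; rewrite mulnb.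
exact: recursive_mul.
Qed.

Lemma decidable_or P Q : rec_decidable P -> rec_decidable Q ->
  rec_decidable (fun x => P x || Q x).
Proof.
move=> hP hQ; apply: (@recursive_ext (fun x => ~~ (~~ P x && ~~ Q x))).
  by move=> x; rewrite negb_and !negbK.
by apply/decidable_neg/decidable_and; exact: decidable_neg.
Qed.

Lemma decidable_leq f g : recursive f -> recursive g ->
  rec_decidable (fun x => f x <= g x).
Proof.
move=> hf hg; apply: (@recursive_ext (fun x => 1 - (f x - g x))).
  by move=> x; rewrite /leq; case: (f x - g x).
apply: recursive_sub; [exact: recursive_const | exact: recursive_sub].
Qed.

Lemma decidable_eq f g : recursive f -> recursive g ->
  rec_decidable (fun x => f x == g x).
Proof.
move=> hf hg; apply: (@recursive_ext (fun x => (f x <= g x) && (g x <= f x))).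
  by move=> x; rewrite -eqn_leq.
by apply: decidable_and; exact: decidable_leq.
Qed.

Lemma recursive_if P f g : rec_decidable P -> recursive f -> recursive g ->
  recursive (fun x => if P x then f x else g x).
Proof.
move=> hP hf hg; apply: (@recursive_ext (fun x => P x * f x + ~~ P x * g x)).
  by move=> x; case: (P x); rewrite ?mul1n ?mul0n ?addn0.
by apply: recursive_add; apply: recursive_mul => //; exact: decidable_neg.
Qed.

Lemma decidable_forall (P : nat -> nat -> bool) n : recursive n ->
  rec_decidable (fun z => P (proj1 z) (proj2 z)) ->
  rec_decidable (fun x => [forall i : 'I_(n x), P x i]).
Proof.
move=> hn hP; apply: (@recursive_ext (fun x =>
  nat_of_bool (\sum_(i < n x) ~~ P x i == 0))).
  move=> x; congr nat_of_bool; rewrite sum_nat_eq0.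
  by apply: eq_forallb => i; rewrite eqb0 negbK.
apply: decidable_eq; last exact: recursive_const.
apply: (recursive_sum (F := fun x i => ~~ P x i)) => //.
exact: decidable_neg.
Qed.

(** Recursiveness of an expression, by the closure lemma for its head symbol. *)
Ltac rec_step := match goal with
  | |- recursive (fun x => x) => exact: recursive_id
  | |- recursive (fun _ => ?n) => exact: recursive_const
  | |- recursive (fun x => nat_of_bool (@?P x)) => change (rec_decidable P)
  | |- recursive (fun x => (@?f x + @?g x)%N) => apply: (@recursive_add f g)
  | |- recursive (fun x => (@?f x - @?g x)%N) => apply: (@recursive_sub f g)
  | |- recursive (fun x => (@?f x * @?g x)%N) => apply: (@recursive_mul f g)
  | |- recursive (fun x => (2 ^ @?f x)%N) => apply: (@recursive_pow2 f)
  | |- recursive (fun x => (@?f x).+1) => apply: (@recursive_S f)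
  | |- recursive (fun x => (@?f x).-1) => apply: (@recursive_pred f)
  | |- recursive (fun x => proj1 (@?f x)) => apply: (@recursive_proj1 f)
  | |- recursive (fun x => proj2 (@?f x)) => apply: (@recursive_proj2 f)
  | |- recursive (fun x => pair_nat (@?f x) (@?g x)) =>
      apply: (@recursive_pair f g)
  | |- recursive (fun x => if _ then _ else _) => apply: recursive_if
  | |- rec_decidable (fun x => ~~ @?P x) => apply: (@decidable_neg P)
  | |- rec_decidable (fun x => @?P x && @?Q x) => apply: (@decidable_and P Q)
  | |- rec_decidable (fun x => @?P x || @?Q x) => apply: (@decidable_or P Q)
  | |- rec_decidable (fun x => @?f x <= @?g x) => apply: (@decidable_leq f g)
  | |- rec_decidable (fun x => @?f x == @?g x) => apply: (@decidable_eq f g)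
  | H : recursive ?f |- recursive (fun x => ?f (@?g x)) =>
      apply: (recursive_comp H (g := g))
  | H : recursive ?f |- recursive ?f => exact: H
  end.

Ltac rec_auto := repeat (rec_step; cbv beta).

(** * Step-bounded evaluation *)

(** The result of c on x without oracle, when every search is cut off after k
    candidates: 0 means no result, y.+1 means result y. The maximum in the case
    of Mu has at most one nonzero term, the least zero found below k. *)
Fixpoint run (c : Defs.code) (k x : nat) : nat :=
  match c with
  | Zero => 1
  | Succ => x.+2
  | Fst => (proj1 x).+1
  | Snd => (proj2 x).+1
  | Oracle => 1
  | Pair f g =>
      if (0 < run f k x) && (0 < run g k x)
      then (pair_nat (run f k x).-1 (run g k x).-1).+1 else 0
  | Comp f g => if 0 < run g k x then run f k (run g k x).-1 else 0
  | Rec f g =>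
      nat_rect (fun=> nat) (run f k (proj1 x))
        (fun i s => if 0 < s
           then run g k (pair_nat (proj1 x) (pair_nat i s.-1)) else 0)
        (proj2 x)
  | Mu f =>
      \max_(y < k) ((run f k (pair_nat x (val y)) == 1) &&
         [forall z : 'I_y, 1 < run f k (pair_nat x (val z))]) * y.+1
  end.

(** By induction on c: a program that evaluates c is assembled from programs
    that evaluate its parts, the bound k turning the search of Mu into a
    maximum over a finite range. *)
Lemma recursive_run c f g : recursive f -> recursive g ->
  recursive (fun x => run c (f x) (g x)).
Proof.
elim: c f g => [|||||c IHc d IHd|c IHc d IHd|c IHc d IHd|c IHc] f g hf hg /=;
  rec_auto.
- exact: IHc.
- exact: IHd.
- exact: IHc.
- exact: IHd.
- exact: IHd.
- by apply: IHc => //; rec_auto; exact: IHd.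
- apply: (recursive_rec (a := fun z => run c (f z) (proj1 (g z)))
    (n := fun z => proj2 (g z))
    (h := fun z i s => if 0 < s then
            run d (f z) (pair_nat (proj1 (g z)) (pair_nat i s.-1)) else 0)).
  + by apply: IHc; rec_auto.
  + by rec_auto.
  + by rec_auto; apply: IHd; rec_auto.
- apply: (recursive_max (F := fun z y => ((run c (f z) (pair_nat (g z) y) == 1)
     && [forall u : 'I_y, 1 < run c (f z) (pair_nat (g z) (val u))]) * y.+1)) => //.
  rec_auto; first by apply: IHc; rec_auto.
  apply: (decidable_forall (P := fun z u => 1 < run c (f (proj1 z))
            (pair_nat (g (proj1 z)) u))); rec_auto.
  by apply: IHc; rec_auto.
Qed.

Lemma bigmax_unique (P : nat -> bool) k y : (forall z, P y -> P z -> z = y) ->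
  y < k -> P y -> \max_(z < k) P z * z.+1 = y.+1.
Proof.
move=> uniq_y yk Py; apply/eqP; rewrite eqn_leq; apply/andP; split.
  by apply/bigmax_leqP => z _; case Pz : (P z) => //; rewrite (uniq_y z) // mul1n.
by apply: leq_trans (leq_bigmax (Ordinal yk)) => /=; rewrite Py mul1n.
Qed.

Lemma run_sound c k x y : run c k x = y.+1 -> computes set0 c x y.
Proof.
elim: c x y => [|||||c IHc d IHd|c IHc d IHd|c IHc d IHd|c IHc] x y /=;
  try by move=> [<-].
- by move=> [<-]; rewrite asboolF.
- case Ec : (run c k x) => [|a] //; case Ed : (run d k x) => [|b] //= -[<-].
  by exists a, b; split; [exact: IHc | exact: IHd |].
- by case Ed : (run d k x) => [|b] //= Ec; exists b; split; [exact: IHd|exact: IHc].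
- case: Cantor.of_nat => a n /=.
  set h := nat_rect _ _ _ => hn; exists (fun i => (h i).-1).
  suff H : 0 < h n -> computes set0 c a (h 0).-1 /\ forall i, i < n ->
     computes set0 d (pair_nat a (pair_nat i (h i).-1)) (h i.+1).-1.
    by case: H; rewrite hn.
  elim: n {hn} => [h0|n IHn /=]; first by split=> //; apply: IHc; rewrite prednK.
  case: ifP => // hn_gt0 hd; have [hc IH] := IHn hn_gt0; split=> // i.
  rewrite ltnS leq_eqVlt => /predU1P[->|/IH//] /=; rewrite -/(h n) hn_gt0.
  by apply: IHd; rewrite prednK.
- move=> E; have : 0 < k by case: k E {IHc} => //; rewrite big_ord0.
  rewrite -{1}(card_ord k) => /bigop.eq_bigmax H.
  have [u Eu] := H (fun u : 'I_k => ((run c k (pair_nat x (val u)) == 1) &&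
         [forall z : 'I_u, 1 < run c k (pair_nat x (val z))]) * u.+1).
  move: E; rewrite {}Eu; case: andP => [[/eqP h1 /forallP h2]|//].
  rewrite mul1n => -[yu].
  rewrite -yu; split; first exact: IHc.
  move=> z zu; have := h2 (Ordinal zu) => /= hz.
  exists (run c k (pair_nat x z)).-2; apply: IHc.
  by case: run hz => [|[|]].
Qed.

Lemma near_forall_lt (P : nat -> nat -> Prop) n :
  (forall i, i < n -> \forall k \near \oo, P i k) ->
  \forall k \near \oo, forall i, i < n -> P i k.
Proof.
move=> h; have H : \forall k \near \oo, forall i : 'I_n, P i k.
  by apply: filter_forall => i; exact: h.
by near=> k => i lin; have := near H k => /(_ _ (Ordinal lin)); apply.
Unshelve. all: by end_near. Qed.

(** Stated for all large bounds, so that the finitely many subcomputations of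
    Rec and Mu succeed at a common bound. *)
Lemma run_complete c x y : computes set0 c x y ->
  \forall k \near \oo, run c k x = y.+1.
Proof.
elim: c x y => [|||||c IHc d IHd|c IHc d IHd|c IHc d IHd|c IHc] x y /=;
  try by move=> ->; exact: nearW.
- by rewrite asboolF // => ->; exact: nearW.
- move=> [a [b [/IHc ha /IHd hb ->]]].
  by near=> k; rewrite (near ha k) // (near hb k).
- move=> [z [/IHd hz /IHc hy]].
  by near=> k; rewrite (near hz k) //= (near hy k).
- case: Cantor.of_nat => a n /= [s [/IHc h0 hS ->]].
  have {}hS := near_forall_lt (fun i lin => IHd _ _ (hS i lin)).
  near=> k.
  have Hd : forall i, i < n -> run d k (pair_nat a (pair_nat i (s i))) = (s i.+1).+1.
    by near: k.
  have : forall i, i <= n -> nat_rect (fun=> nat) (run c k a)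
    (fun i s0 => if 0 < s0 then run d k (pair_nat a (pair_nat i s0.-1)) else 0) i
      = (s i).+1; last by apply.
  elim=> [_ /=|i IHi lin /=]; first by near: k.
  by rewrite IHi ?(ltnW lin) //= Hd.
- move=> [/IHc hy hz].
  have {}hz : \forall k \near \oo, forall z, z < y ->
      1 < run c k (pair_nat x z).
    apply: near_forall_lt => z /hz[v /IHc hv].
    by near=> k; rewrite (near hv k).
  near=> k.
  have Hy : run c k (pair_nat x y) = 1 by near: k.
  have Hz : forall z, z < y -> 1 < run c k (pair_nat x z) by near: k.
  apply: (@bigmax_unique (fun y0 => (run c k (pair_nat x y0) == 1) &&
         [forall z : 'I_y0, 1 < run c k (pair_nat x (val z))])).
  + move=> z _ /andP[/eqP Ez /forallP Fz]; case: (ltngtP z y) => // zy.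
      by have := Hz z zy; rewrite Ez.
    by have := Fz (Ordinal zy); rewrite /= Hy.
  + by near: k; exact: nbhs_infty_gt.
  + by rewrite Hy eqxx /=; apply/forallP => z; exact: Hz.
Unshelve. all: by end_near. Qed.

(** * Sets that are c.e. in the halting problem *)

Lemma computes_unique A c x y z : computes A c x y -> computes A c x z -> y = z.
Proof.
elim: c x y z => [|||||c IHc d IHd|c IHc d IHd|c IHc d IHd|c IHc] x y z /=;
  try by move=> -> ->.
- move=> [a [b [ha hb ->]]] [a' [b' [ha' hb' ->]]].
  by rewrite (IHc _ _ _ ha ha') (IHd _ _ _ hb hb').
- move=> [w [hw hy]] [w' [hw' hz]]; move: hz; rewrite -(IHd _ _ _ hw hw').
  exact: IHc.
- case: Cantor.of_nat => a n [s [h0 hS ->]] [s' [h0' hS' ->]].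
  suff H : forall i, i <= n -> s i = s' i by exact: H.
  elim=> [_|i IHi lin]; first exact: IHc h0 h0'.
  have := hS' i lin; rewrite -IHi ?(ltnW lin) //; exact/IHd/hS.
- move=> [hy ly] [hz lz]; case: (ltngtP y z) => // [/lz|/ly] [v hv].
    by have := IHc _ _ _ hy hv.
  by have := IHc _ _ _ hz hv.
Qed.

Lemma pair_nat_inj a b c d : pair_nat a b = pair_nat c d -> a = c /\ b = d.
Proof.
by move=> /(congr1 Cantor.of_nat); rewrite !Cantor.cancel_of_to => -[].
Qed.

Lemma godel_inj c d : godel c = godel d -> c = d.
Proof.
elim: c d => [|||||c IHc d IHd|c IHc d IHd|c IHc d IHd|c IHc]
  [|||||c' d'|c' d'|c' d'|c'] /=
  /pair_nat_inj[] // _; try by move=> /pair_nat_inj[/IHc-> /IHd->].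
by move=> /IHc->.
Qed.

Fixpoint const_code (n : nat) : Defs.code :=
  if n is m.+1 then Comp Succ (const_code m) else Zero.

Lemma computes_const A n x : computes A (const_code n) x n.
Proof. by elim: n => [|n IH] //=; exists n. Qed.

(** The halting problem is about programs run on their own number. Composing d
    with a constant makes the input irrelevant, so halting of d on any n is a
    question to the oracle, whose number is recursive in n
    ([recursive_comp_const]). *)
Lemma halting_problem_comp_const d n :
  halting_problem (godel (Comp d (const_code n))) <-> halts set0 d n.
Proof.
split=> [[c [/godel_inj -> [y [z [hz hy]]]]]|[y hy]].
  by exists y; rewrite (computes_unique (computes_const set0 n _) hz).
exists (Comp d (const_code n)); split=> //; exists y, n; split=> //.
exact: computes_const.
Qed.

Lemma recursive_comp_const d f : recursive f ->
  recursive (fun x => godel (Comp d (const_code (f x)))).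
Proof.
move=> hf; apply: (@recursive_ext (fun x => pair_nat 6 (pair_nat (godel d)
  (nat_rect (fun=> nat) (godel Zero)
     (fun i s => pair_nat 6 (pair_nat (godel Succ) s)) (f x))))).
  move=> x; rewrite [RHS]/=; do 2!congr (Cantor.to_nat (_, _)).
  by elim: (f x) => [|n /= ->].
rec_auto; apply: (recursive_rec (a := fun=> godel Zero)
  (h := fun x i s => pair_nat 6 (pair_nat (godel Succ) s))) => //; rec_auto.
Qed.

(** A counterexample to forall v, r n u v is found by an unbounded search, so
    the oracle decides whether this statement holds; a second search, relative
    to the oracle, finds u. *)
Lemma ce_in_halting_problem (r : nat -> nat -> nat -> bool) :
  rec_decidable (fun z => r (proj1 (proj1 z)) (proj2 (proj1 z)) (proj2 z)) ->
  ce_in halting_problem [set n | exists u, forall v, r n u v].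
Proof.
move=> [cr hcr].
have [cs hcs] := recursive_comp_const (Mu cr) recursive_id.
have hMu n u : halts set0 (Mu cr) (pair_nat n u) <-> exists v, ~~ r n u v.
  have hr v : computes set0 cr (pair_nat (pair_nat n u) v) (r n u v).
    by have := hcr set0 (pair_nat (pair_nat n u) v); rewrite !projE.
  split=> [[v [hv _]]|ex].
    by exists v; have := computes_unique hv (hr v); case: (r n u v).
  have [v hv minv] := ex_minnP ex; exists v; split.
    by have := hr v; rewrite (negbTE hv).
  move=> w wv; exists 0; have := hr w; case E : (r n u w) => //.
  by have := minv w; rewrite E leqNgt wv => /(_ isT).
pose s n u := godel (Comp (Mu cr) (const_code (pair_nat n u))).
have hHP n u : halting_problem (s n u) <-> exists v, ~~ r n u v.
  by rewrite -hMu; exact: halting_problem_comp_const.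
have hs A n u v : computes A (Comp Oracle cs) (pair_nat n u) v <->
    v = nat_of_bool `[< A (s n u) >].
  split=> [[w [hw ->]]|->].
    by rewrite (computes_unique hw (hcs A _)).
  by exists (s n u); split; first exact: hcs.
exists (Mu (Comp Oracle cs)); apply/seteqP; split=> n /=.
  move=> [u hu].
  have ex : exists u, ~~ `[< halting_problem (s n u) >].
    exists u; apply/asboolPn => /hHP [v].
    by rewrite hu.
  have [w hw minw] := ex_minnP ex; exists w; split.
    by apply/hs; rewrite (negbTE hw).
  move=> z zw; exists 0; apply/hs; case: asboolP => // hz.
  by have := minw z; rewrite leqNgt zw => /(_ (introT (asboolPn _) hz)).
move=> [u [/hs hu _]]; exists u => v; apply: contraT => rv; move: hu.
by rewrite asboolT //; apply/hHP; exists v.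
Qed.

(** * Strings as dyadic rationals *)

Definition strval (s : seq bool) : nat :=
  foldl (fun n (b : bool) => n.*2 + b) 0 s.

(** The string number n has length len n and binary value numer n, so it stands
    for the dyadic rational numer n / 2 ^ len n. *)
Definition len (n : nat) : nat := trunc_log 2 n.+1.

Definition numer (n : nat) : nat := n.+1 - 2 ^ len n.

Lemma strval_rcons s b : strval (rcons s b) = (strval s).*2 + b.
Proof. by rewrite /strval -cats1 foldl_cat. Qed.

Lemma strval_lt s : strval s < 2 ^ size s.
Proof.
elim/last_ind: s => [|s b IH] //; rewrite strval_rcons size_rcons expnS.
by case: b; lia.
Qed.

Lemma string_codeE s : (string_code s).+1 = 2 ^ size s + strval s.
Proof.
rewrite /string_code.
have E : foldl (fun n (b : bool) => n.*2 + b) 1 s = 2 ^ size s + strval s.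
  elim/last_ind: s => [|s b IH] //; rewrite -cats1 foldl_cat IH cats1 /=.
  by rewrite strval_rcons size_rcons expnS; lia.
by rewrite E prednK // addn_gt0 expn_gt0.
Qed.

Lemma len_string_code s : len (string_code s) = size s.
Proof.
rewrite /len string_codeE; apply: trunc_log_eq => //.
by rewrite leq_addr expnS mul2n -addnn ltn_add2l strval_lt.
Qed.

Lemma numer_string_code s : numer (string_code s) = strval s.
Proof. by rewrite /numer len_string_code string_codeE addKn. Qed.

Lemma strval_inj s t : size s = size t -> strval s = strval t -> s = t.
Proof.
elim/last_ind: s t => [|s b IH] t; first by case: t.
elim/last_ind: t => [|t c _]; rewrite !size_rcons // => -[st].
rewrite !strval_rcons => E.
have bc : b = c by case: b c E => -[] //; lia.
by rewrite bc (IH t) //; move: E; rewrite bc; lia.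
Qed.

Lemma string_code_inj : injective string_code.
Proof.
move=> s t E; apply: strval_inj; first by rewrite -!len_string_code E.
by rewrite -!numer_string_code E.
Qed.

Lemma string_code_rcons s b :
  string_code (rcons s b) = (string_code s).*2 + b.+1.
Proof.
have := string_codeE (rcons s b); have := string_codeE s.
by rewrite size_rcons strval_rcons expnS; lia.
Qed.

Lemma string_code_surj n : exists s, string_code s = n.
Proof.
elim/ltn_ind: n => -[_|n IH]; first by exists [::].
have [s Es] : exists s, string_code s = n./2 by apply: IH; lia.
by exists (rcons s (odd n)); rewrite string_code_rcons Es; lia.
Qed.

Definition string_of (n : nat) : seq bool := projT1 (cid (string_code_surj n)).

Lemma string_ofK : cancel string_of string_code.
Proof. by move=> n; rewrite /string_of; case: cid. Qed.

Lemma string_codeK : cancel string_code string_of.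
Proof. by move=> s; apply: string_code_inj; rewrite string_ofK. Qed.

Lemma len_le n : len n <= n.
Proof.
rewrite -ltnS; apply: leq_trans (ltn_expl (len n) (isT : 1 < 2)) _.
exact: trunc_logP.
Qed.

Definition prefix_val (x : nat -> bool) (n : nat) : nat := strval (mkseq x n).

Lemma prefix_valS x n : prefix_val x n.+1 = (prefix_val x n).*2 + x n.
Proof. by rewrite /prefix_val mkseqS strval_rcons. Qed.

Lemma lt_left_rcons s b x : lt_left (rcons s b) x <->
  lt_left s x \/ [/\ s = mkseq x (size s), b = false & x (size s) = true].
Proof.
split=> [[n [] ]|[[n [ns tk sn xn]]|[sE bE xE]]].
- rewrite size_rcons ltnS leq_eqVlt => /predU1P[->|ns].
    rewrite -cats1 take_size_cat // nth_cat ltnn subnn /= => tk bE xE.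
    by right; split.
  rewrite -cats1 takel_cat ?(ltnW ns) // nth_cat ns => tk sn xn.
  by left; exists n; split.
- exists n; rewrite size_rcons -cats1 takel_cat ?(ltnW ns) // nth_cat ns.
  by split=> //; exact: ltnW.
- exists (size s); rewrite size_rcons -cats1 take_size_cat // nth_cat ltnn.
  by rewrite subnn; split.
Qed.

Lemma lt_left_prefix_val s x :
  lt_left s x <-> strval s < prefix_val x (size s).
Proof.
elim/last_ind: s => [|s b IH]; first by split=> // -[n []].
rewrite lt_left_rcons IH size_rcons prefix_valS strval_rcons.
have sE : s = mkseq x (size s) <-> strval s = prefix_val x (size s).
  split=> [{1}->//|]; apply: strval_inj; by rewrite size_mkseq.
rewrite (propext sE); split=> [[h|[-> -> ->]]|h].
- by case: b; case: (x _); lia.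
- by rewrite addn0 addn1.
have [lt_s|eq_s] : strval s < prefix_val x (size s) \/
   strval s = prefix_val x (size s) by case: b h; case: (x _); lia.
  by left.
by right; case: b h; case: (x _); split=> //; lia.
Qed.

(** On strings of equal length the lexicographic order is the order of the
    binary values. *)
Lemma le_left_prefix_val s x :
  le_left s x <-> strval s <= prefix_val x (size s).
Proof.
rewrite /le_left lt_left_prefix_val [strval s <= _]leq_eqVlt; split.
  by case=> [->|{1}->]; rewrite ?orbT // /prefix_val eqxx.
case/predU1P => [E|]; [right|by left].
by apply: strval_inj E; rewrite size_mkseq.
Qed.

Lemma prefix_val_lt x n : prefix_val x n < 2 ^ n.
Proof. by have := strval_lt (mkseq x n); rewrite size_mkseq. Qed.

(** The dyadic rational of a prefix of x lies in the dyadic interval, open on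
    the right, of any other prefix of x. *)
Lemma prefix_val_mul x l N :
  prefix_val x l * 2 ^ N < (prefix_val x N).+1 * 2 ^ l.
Proof.
have lo n k : prefix_val x n * 2 ^ k <= prefix_val x (n + k).
  elim: k => [|k IH]; first by rewrite muln1 addn0.
  by rewrite addnS prefix_valS expnS; lia.
have hi n k : prefix_val x (n + k) < (prefix_val x n).+1 * 2 ^ k.
  elim: k => [|k IH]; first by rewrite muln1 addn0.
  by rewrite addnS prefix_valS expnS; case: (x _) => /=; lia.
case: (leqP N l) => [/subnKC <-|/ltnW /subnKC <-].
  have := hi N (l - N).
  by rewrite -(ltn_pmul2r (expn_gt0 2 N)) expnD; lia.
have := lo l (N - l).
have := expn_gt0 2 l; have := expn_gt0 2 (N - l).
rewrite expnD; nia.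
Qed.

(** The strings t with 0.t < i / 2 ^ N, resp. 0.t <= i / 2 ^ N. *)
Definition below (i N : nat) : set nat :=
  [set n | numer n * 2 ^ N < i * 2 ^ len n].

Definition upto (i N : nat) : set nat :=
  [set n | numer n * 2 ^ N <= i * 2 ^ len n].

Definition left_of (x : nat -> bool) : set nat :=
  [set n | numer n <= prefix_val x (len n)].

Lemma left_of_below x i N : prefix_val x N < i -> left_of x `<=` below i N.
Proof.
move=> xi n nx; apply: leq_ltn_trans (leq_mul nx (leqnn (2 ^ N))) _.
apply: leq_trans (prefix_val_mul x (len n) N) _.
by rewrite leq_mul2r xi orbT.
Qed.

Lemma upto_left_of x i N : i <= prefix_val x N -> upto i N `<=` left_of x.
Proof.
move=> ix n ni; rewrite /left_of /= -ltnS -(ltn_pmul2r (expn_gt0 2 N)).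
apply: leq_ltn_trans ni _; apply: leq_ltn_trans (prefix_val_mul x N (len n)).
by rewrite leq_mul2r ix orbT.
Qed.

Local Open Scope ring_scope.

(** * The values of the distribution function and its gaps *)

Section WeightedMass.
Variables (R : realType) (w : nat -> R).
Hypothesis w_ge0 : forall n, 0 <= w n.
Hypothesis w_le1 : forall N, \sum_(n < N) w n <= 1.

Definition mass (Y : set nat) : R := limn (series (fun n => \1_Y n * w n)).

Let term_ge0 (Y : set nat) n : 0 <= \1_Y n * w n :> R.
Proof. by rewrite mulr_ge0. Qed.

Let nd_partial (Y : set nat) : nondecreasing_seq (series (fun n => \1_Y n * w n)).
Proof. by apply: nondecreasing_series => n _ _; exact: term_ge0. Qed.

Let partial_le1 (Y : set nat) N : series (fun n => \1_Y n * w n) N <= 1.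
Proof.
rewrite /series /= big_mkord; apply: le_trans (w_le1 N); apply: ler_sum => n _.
by rewrite indicE; case: (_ \in _); rewrite ?mul1r ?mul0r.
Qed.

Let cvg_partial (Y : set nat) : cvgn (series (fun n => \1_Y n * w n)).
Proof.
apply: nondecreasing_is_cvgn; first exact: nd_partial.
by exists 1 => _ [n _ <-]; exact: partial_le1.
Qed.

Lemma partial_le_mass (Y : set nat) N : \sum_(n < N) \1_Y n * w n <= mass Y.
Proof.
rewrite -(big_mkord xpredT (fun n => \1_Y n * w n)).
exact: (nondecreasing_cvgn_le (@nd_partial Y) (@cvg_partial Y)).
Qed.

Lemma lt_mass_partial (Y : set nat) r : r < mass Y ->
  exists N, r < \sum_(n < N) \1_Y n * w n.
Proof.
move=> rY; apply: contrapT => /forallNP H.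
move: rY; rewrite ltNge => /negP; apply.
apply: limr_le; first exact: cvg_partial.
apply: nearW => N; rewrite leNgt /series /= big_mkord; apply/negP; exact: H.
Qed.

Lemma mass_ge0 Y : 0 <= mass Y.
Proof. by have := partial_le_mass Y 0; rewrite big_ord0. Qed.

Lemma mass_le1 Y : mass Y <= 1.
Proof.
apply: limr_le; first exact: cvg_partial.
by apply: nearW => N; exact: partial_le1.
Qed.

(** The only additivity used below: an inequality between sums of indicators
    integrates. *)
Lemma le_massD (A B C D : set nat) :
  (forall n, \1_A n + \1_B n <= \1_C n + \1_D n :> R) ->
  mass A + mass B <= mass C + mass D.
Proof.
move=> H; rewrite /mass -!lim_seriesD //.
apply: lim_series_le; [exact: is_cvg_seriesD | exact: is_cvg_seriesD|].
by move=> n; rewrite [leLHS]/= -[leLHS]mulrDl -[leRHS]mulrDl ler_wpM2r.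
Qed.

Lemma mass0 : mass set0 = 0.
Proof.
apply/eqP; rewrite eq_le mass_ge0 andbT leNgt; apply/negP => /lt_mass_partial.
by move=> [N]; rewrite big1 ?ltxx // => n _; rewrite indic0 mul0r.
Qed.

Lemma le_mass A B : A `<=` B -> mass A <= mass B.
Proof.
move=> AB; have : mass A + mass set0 <= mass B + mass set0.
  apply: le_massD => n; rewrite lerD2r !indicE.
  case: (boolP (n \in A)) => //; rewrite inE => /AB Bn.
  by rewrite (mem_set Bn).
by rewrite lerD2r.
Qed.

Lemma mass_le_setU A B C : A `<=` B `|` C -> mass A <= mass B + mass C.
Proof.
move=> ABC; rewrite -[leLHS]addr0 -mass0; apply: le_massD => n.
rewrite indic0 addr0 !indicE; case: (boolP (n \in A)) => [|_]; last first.
  by rewrite -natrD.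
by rewrite inE => /ABC[/mem_set->|/mem_set->]; rewrite -natrD ler1n;
  case: (_ \in _).
Qed.

Lemma mass_len_lt (e : R) : 0 < e -> exists N, mass [set n | (N < len n)%N] < e.
Proof.
move=> e0.
have [N HN] : exists N, mass setT - e < \sum_(n < N) \1_[set: nat] n * w n.
  by apply: lt_mass_partial; rewrite ltrBlDr ltrDl.
exists N; have h1 : \sum_(n < N) \1_[set: nat] n * w n <= mass [set n | (n < N)%N].
  apply: le_trans (partial_le_mass _ N); apply: ler_sum => n _.
  by rewrite !indicE !mem_set //=.
have : mass [set n | (N < len n)%N] + mass [set n | (n < N)%N] <=
       mass setT + mass set0.
  apply: le_massD => n; rewrite !indicE in_setT in_set0 /= addr0 -natrD.
  rewrite ler_nat; case: (boolP (n \in _)) => [|_]; last by case: (_ \in _).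
  rewrite inE /= => Nn; case: (boolP (n \in _)) => //; rewrite inE /= => nN.
  by have := len_le n; lia.
rewrite mass0; lra.
Qed.

(** The value f(x) of the theorem when w gives the weights of the strings
    ([left_weight_value]). *)
Definition value (x : nat -> bool) : R := mass (left_of x).

(** The two ends are exceptional: the gap at 0 extends to -oo, and the gap at
    1 to +oo. *)
Definition in_gap (r : R) (i N : nat) : Prop :=
  (i = 0%N \/ mass (below i N) < r) /\
  ((2 ^ N <= i)%N \/ r < mass (upto i N)).

Lemma value_not_in_gap x i N : ~ in_gap (value x) i N.
Proof.
move=> [hl hu]; have [xi|ix] := ltnP (prefix_val x N) i.
  case: hl => [i0|]; first by rewrite i0 in xi.
  by rewrite ltNge le_mass //; exact: left_of_below.
case: hu => [Ni|]; last by rewrite ltNge le_mass //; exact: upto_left_of.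
by have := prefix_val_lt x N; rewrite ltnNge (leq_trans Ni ix).
Qed.

Lemma upto_double i N : upto i.*2 N.+1 = upto i N.
Proof. by rewrite /upto; apply/seteqP; split=> n /=; rewrite expnS; lia. Qed.

(** If t has length at most N, then 0.t is a multiple of 1 / 2 ^ N. *)
Lemma below_subset i N : below i.+1 N `<=` upto i N `|` [set n | (N < len n)%N].
Proof.
rewrite /below /upto => n /=.
case: (ltnP N (len n)) => [|nN lt_n]; [by right|left].
move: lt_n; rewrite -(subnK nN) expnD !mulnA !ltn_pmul2r ?expn_gt0 // ltnS.
by move=> le_n; rewrite /= leq_mul.
Qed.

Lemma upto_below i N : upto i N `<=` below i.+1 N.
Proof.
move=> n ni; apply: leq_ltn_trans ni _.
by rewrite ltn_pmul2r ?expn_gt0.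
Qed.

Lemma below_upto i N : below i N `<=` upto i N.
Proof. by move=> n; exact: ltnW. Qed.

Lemma value_bounds x N :
  mass (upto (prefix_val x N) N) <= value x <= mass (below (prefix_val x N).+1 N).
Proof.
by apply/andP; split; apply: le_mass; [exact: upto_left_of|exact: left_of_below].
Qed.

(** Let i be least with i >= 2 ^ N or r < mass (upto i N). As r avoids the gap
    at 0, i is positive, say i = u(N) + 1; then mass (upto (u N) N) <= r, and
    r <= mass (below i N) because r avoids the gap at i. Refining the dyadic grid shows that u(N+1) is
    2 u(N) or 2 u(N) + 1, so the parities of the u(N) are the bits of a
    sequence x with prefixes u(N). *)
Lemma value_of_not_in_gap r : (forall i N, ~ in_gap r i N) ->
  exists x, value x = r.
Proof.
move=> H; pose P N i := (2 ^ N <= i)%N || `[< r < mass (upto i N) >].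
have exP N : exists i, P N i by exists (2 ^ N)%N; rewrite /P leqnn.
pose u N := (ex_minn (exP N)).-1.
have uP N : [/\ (u N < 2 ^ N)%N, mass (upto (u N) N) <= r,
    r <= mass (below (u N).+1 N) & P N (u N).+1].
  rewrite /u; case: ex_minnP => m Pm minm.
  have m_gt0 : (0 < m)%N.
    rewrite lt0n; apply/eqP => m0; case: (H 0%N N); split; first by left.
    by move: Pm; rewrite /P m0 => /orP[|/asboolP]; [left|right].
  rewrite prednK //; split=> //.
  - by apply: minm; rewrite /P leqnn.
  - rewrite leNgt; apply/negP => ltr; have := minm m.-1.
    by rewrite /P asboolT // orbT leqNgt prednK // leqnn => /(_ isT).
  - rewrite leNgt; apply/negP => ltr; case: (H m N); split; first by right.
    by move: Pm => /orP[|/asboolP]; [left|right].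
have P_double N i : P N.+1 i.*2 = P N i.
  by rewrite /P upto_double expnS mul2n leq_double.
have leu N i : P N i -> (u N < i)%N.
  rewrite /u; case: ex_minnP => -[|m] Pm minm /minm //= _.
  case: (H 0%N N); split; first by left.
  by move: Pm => /orP[|/asboolP]; [left|right].
have uS N : u N.+1 = ((u N).*2 + odd (u N.+1))%N.
  have [uN ur _ Pu] := uP N; have [uN' _ _ Pu'] := uP N.+1.
  have : (u N.+1 < (u N).+1.*2)%N.
    by apply: leu; rewrite P_double.
  suff : ((u N).*2 <= u N.+1)%N by have := odd_double_half (u N.+1); lia.
  rewrite leqNgt; apply/negP => lt_u; move: Pu' => /orP[|/asboolP].
    by rewrite expnS; lia.
  apply/negP; rewrite -leNgt; apply: le_trans ur; rewrite -[upto (u N) N]upto_double.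
  apply: le_mass; rewrite /upto => n /= n_le; apply: leq_trans n_le _.
  by rewrite leq_mul2r lt_u orbT.
pose x n := odd (u n.+1).
have xu n : prefix_val x n = u n.
  elim: n => [|n IHn]; last by rewrite prefix_valS IHn [RHS]uS.
  by have [] := uP 0%N; case: (u 0%N).
exists x; apply: contrapT => /eqP; rewrite -subr_eq0 -normr_gt0.
move=> /mass_len_lt[N]; apply/negP; rewrite -leNgt.
have /andP[] := value_bounds x N; have [_ + + _] := uP N.
have := mass_le_setU (@below_subset (u N) N); rewrite !xu => h1 h2 h3 h4 h5.
by rewrite ler_norml; lra.
Qed.

(** In the k-th step, a string of below k.+1 that is not in upto k is longer
    than N and is counted for the first time. *)
Lemma sum_gaps_le N k :
  \sum_(i < k) (mass (below i.+1 N) - mass (upto i N)) <=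
  mass ([set n | (N < len n)%N] `&` below k N).
Proof.
elim: k => [|k IHk]; first by rewrite big_ord0 mass_ge0.
rewrite big_ord_recr /=; apply: le_trans (lerD IHk (lexx _)) _.
suff : mass (below k.+1 N) + mass ([set n | (N < len n)%N] `&` below k N) <=
  mass (upto k N) + mass ([set n | (N < len n)%N] `&` below k.+1 N) by lra.
apply: le_massD => n; rewrite !indicE !in_setI.
have h1 : n \in below k N -> n \in upto k N.
  by rewrite !inE; exact: below_upto.
have h2 : n \in upto k N -> n \in below k.+1 N.
  by rewrite !inE; exact: upto_below.
have h3 : n \in below k.+1 N -> (n \in upto k N) || (n \in [set n | (N < len n)%N]).
  by rewrite inE => /below_subset[] /mem_set ->; rewrite ?orbT.
move: h1 h2 h3; case: (n \in below k N); case: (n \in upto k N);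
  case: (n \in below k.+1 N); case: (n \in [set n | (N < len n)%N]) => //=;
  rewrite -?natrD ?ler_nat // => h1 h2 h3; try (by have := h1 isT);
  try (by have := h2 isT); by have := h3 isT.
Qed.

(** Level N covers the range by 2 ^ N closed intervals of total length at most
    the mass of the strings longer than N. *)
Lemma range_value_measure0 :
  measurable (range value : set (measurableTypeR R)) ->
  lebesgue_measure (range value : set (measurableTypeR R)) = 0%E.
Proof.
move=> mP; apply/eqP; rewrite eq_le measure_ge0 andbT.
apply/lee_addgt0Pr => e e0; rewrite add0e; have [N HN] := mass_len_lt e0.
pose I (i : nat) : set R := `[mass (upto i N), mass (below i.+1 N)]%classic.
have mI i : measurable (I i : set (measurableTypeR R)) by exact: measurable_itv.
have lI i : (lebesgue_measure (I i : set (measurableTypeR R)) <=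
    (mass (below i.+1 N) - mass (upto i N))%:E)%E.
  rewrite [X in (X <= _)%E]lebesgue_measure_itv /=.
  case: ifP => // _; rewrite lee_fin subr_ge0; exact/le_mass/upto_below.
apply: (@le_trans _ _ (lebesgue_measure
   (\big[setU/set0]_(i < 2 ^ N) I i : set (measurableTypeR R)))).
  apply: le_measure; rewrite ?inE //.
    by apply: bigsetU_measurable => i _; exact: mI.
  move=> _ [x _ <-]; rewrite -(bigcup_mkord (2 ^ N) I); exists (prefix_val x N).
    exact: prefix_val_lt.
  by rewrite /I /= in_itv /= value_bounds.
apply: le_trans (Boole_inequality _ _) _; first by move=> i _; exact: mI.
apply: (@le_trans _ _ (\sum_(i < 2 ^ N)
    (mass (below i.+1 N) - mass (upto i N))%:E)%E).
  by apply: lee_sum => i _; exact: lI.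
rewrite sumEFin lee_fin; apply: le_trans (sum_gaps_le _ _) _.
by apply: le_trans (ltW HN); apply: le_mass => n [].
Qed.

End WeightedMass.

(** * Kraft's inequality and the weights of a machine *)

(** If the empty string is present, it is the only member. Otherwise split by
    the first bit: deleting it leaves a prefix-free family and doubles the
    weights, so by induction on the maximal length each of the two parts has
    weight at most 1/2. *)
Lemma kraft (R : realType) (l : seq (seq bool)) : uniq l ->
  (forall s t, s \in l -> t \in l -> prefix s t -> s = t) ->
  \sum_(t <- l) 2 ^- size t <= 1 :> R.
Proof.
have [n] : exists n, all (fun t => size t <= n)%N l.
  elim: l => [|t l [n ln]]; first by exists 0%N.
  exists (maxn n (size t)); rewrite /= leq_maxr /=.
  by apply: sub_all ln => s sn; rewrite leq_max sn.
elim: n l => [|n IHn] l ln ul pl.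
  case: l ln ul pl => [|s [|t l]] /=; first by rewrite big_nil.
    by rewrite andbT leqn0 => /nilP-> _ _; rewrite big_seq1 expr0 invr1.
  by rewrite !leqn0 => /and3P[/nilP-> /nilP->].
have [nil_l|nil_l] := boolP ([::] \in l).
  have -> : l = [:: [::]].
    case: l ul {ln} pl nil_l => [//|s l] /= /andP[sl ul] pl nil_l.
    have nilE t : t \in s :: l -> t = [::].
      by move=> t_l; apply/esym/pl; rewrite ?prefix0s.
    rewrite (nilE s) ?mem_head //; case: l sl nilE {ul pl nil_l} => // t l.
    rewrite in_cons => /norP[/eqP st _] nilE; case: st.
    by rewrite (nilE s) ?mem_head // (nilE t) // !in_cons eqxx orbT.
  by rewrite big_seq1 expr0 invr1.
(* The default ~~ b of head keeps the empty string out of both parts. *)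
pose tl b := [seq behead t | t <- l & head (~~ b) t == b].
have tlP b t : t \in l -> head (~~ b) t == b -> t = b :: behead t.
  by case: t => [|c t] _ /= => [|/eqP->//]; case: b.
have half b : \sum_(t <- l | head (~~ b) t == b) (2 : R) ^- size t <= 2^-1.
  have -> : \sum_(t <- l | head (~~ b) t == b) (2 : R) ^- size t =
      2^-1 * \sum_(t <- tl b) 2 ^- size t.
    rewrite big_map big_filter mulr_sumr big_seq_cond [RHS]big_seq_cond.
    apply: eq_bigr => t /andP[t_l tb].
    by rewrite {1}(tlP _ _ t_l tb) /= exprS invfM.
  rewrite -[leRHS]mulr1 ler_wpM2l ?invr_ge0 //; apply: IHn.
  - apply/allP => s /mapP[t]; rewrite mem_filter => /andP[tb t_l] ->.
    by have := allP ln _ t_l; rewrite {1}(tlP _ _ t_l tb).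
  - rewrite map_inj_in_uniq ?filter_uniq // => s t; rewrite !mem_filter.
    by move=> /andP[sb sl] /andP[tb t_l] E; rewrite (tlP _ _ sl sb) E -tlP.
  - move=> _ _ /mapP[s + ->] /mapP[t + ->]; rewrite !mem_filter.
    move=> /andP[sb sl] /andP[tb t_l] pst.
    suff -> : s = t by [].
    apply: pl => //; rewrite (tlP _ _ sl sb) (tlP _ _ t_l tb) /= eqxx.
    exact: pst.
rewrite (bigID (fun t => head (~~ true) t == true)) /=.
have -> : \sum_(t <- l | head false t != true) (2 : R) ^- size t =
    \sum_(t <- l | head (~~ false) t == false) 2 ^- size t.
  rewrite big_seq_cond [RHS]big_seq_cond; apply: eq_bigl => -[|[] t] //=.
  by rewrite (negbTE nil_l).
by have := half true; have := half false; lra.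
Qed.

Lemma K_Some U s k : K U s = Some k -> exists t, size t = k /\ U t = Some s.
Proof.
rewrite /K; case: pselect => // ex [<-]; case: ex_minnP => m /asboolP //.
Qed.

Lemma K_le U s t : U t = Some s -> exists2 k, K U s = Some k & (k <= size t)%N.
Proof.
move=> Ut; have Pt : `[< exists t', size t' = size t /\ U t' = Some s >].
  by apply/asboolP; exists t.
rewrite /K; case: pselect => [ex|[]]; last by exists (size t).
by exists (ex_minn ex) => //; case: ex_minnP => m _; apply.
Qed.

Section Machine.
Variables (R : realType) (U : seq bool -> option (seq bool)).

Definition string_weight (n : nat) : R := weight R (K U (string_of n)).

Lemma string_weight_ge0 n : 0 <= string_weight n.
Proof. by rewrite /string_weight; case: K => //= k; rewrite invr_ge0 exprn_ge0. Qed.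

(** Distinct strings have distinct shortest descriptions, and these form a
    prefix-free family. *)
Lemma sum_string_weight_le1 N : prefix_free [set t | U t != None] ->
  \sum_(n < N) string_weight n <= 1.
Proof.
move=> pfU.
have /choice[d hd] : forall n, exists t, forall k, K U (string_of n) = Some k ->
    size t = k /\ U t = Some (string_of n).
  move=> n; case E : (K U (string_of n)) => [k|]; last by exists [::].
  by have [t ht] := K_Some E; exists t => _ [<-].
pose l := [seq n <- iota 0 N | K U (string_of n) != None].
have hl n : n \in l ->
    string_weight n = 2 ^- size (d n) /\ U (d n) = Some (string_of n).
  rewrite mem_filter /string_weight; case E : K => [k|] //= _.
  by have [-> ->] := hd _ _ E.
have -> : \sum_(n < N) string_weight n = \sum_(t <- map d l) 2 ^- size t.
  rewrite big_map -(big_mkord xpredT) /index_iota subn0.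
  rewrite (bigID (fun n => K U (string_of n) != None)) /= [X in _ + X]big1.
    rewrite addr0 -big_filter big_seq [RHS]big_seq.
    by apply: eq_bigr => n /hl[].
  by move=> n; rewrite negbK /string_weight => /eqP ->.
apply: kraft.
  rewrite map_inj_in_uniq ?filter_uniq ?iota_uniq // => m n /hl[_ Um] /hl[_ Un].
  by move=> E; move: Um; rewrite E Un => -[/(can_inj string_ofK)].
move=> _ _ /mapP[m /hl[_ Um] ->] /mapP[n /hl[_ Un] ->].
by apply: pfU; rewrite /= ?Um ?Un.
Qed.

Lemma left_weight_value x : prefix_free [set t | U t != None] ->
  left_weight R U x = (value string_weight x)%:E.
Proof.
move=> pfU; rewrite /left_weight.
have -> : \esum_(s in [set s | le_left s x]) (weight R (K U s))%:E =
    \esum_(n in left_of x) (string_weight n)%:E.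
  rewrite (reindex_esum [set s | le_left s x] _ string_code).
    by apply: eq_esum => s _; rewrite /string_weight string_codeK.
  split=> [s /= /le_left_prefix_val|s t _ _|n /= nx].
  - by rewrite /left_of /= len_string_code numer_string_code.
  - exact: string_code_inj.
  - exists (string_of n); last exact: string_ofK.
    apply/le_left_prefix_val.
    by rewrite -len_string_code -numer_string_code string_ofK.
rewrite -(@nneseries_esum _ _ (fun n => numer n <= prefix_val x (len n))%N).
  rewrite /value /mass -EFin_lim; last first.
    apply: nondecreasing_is_cvgn.
      by apply: nondecreasing_series => n _ _; rewrite mulr_ge0 ?string_weight_ge0.
    exists 1 => _ [n _ <-]; apply: le_trans (sum_string_weight_le1 n pfU).
    rewrite /series /= big_mkord; apply: ler_sum => i _.
    by rewrite indicE; case: (_ \in _); rewrite ?mul1r ?mul0r ?string_weight_ge0.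
  congr (limn _); apply/funext => n /=; rewrite /series /= -sumEFin big_mkcond.
  apply: eq_bigr => i _; rewrite indicE; case: ifP => le_i.
    by rewrite mem_set ?mul1r.
  by rewrite memNset ?mul0r // /left_of /= le_i.
by move=> n _; rewrite lee_fin string_weight_ge0.
Qed.

End Machine.

(** * Computable approximation of masses *)

Lemma recursive_len f : recursive f -> recursive (fun x => len (f x)).
Proof.
move=> hf; apply: (@recursive_ext (fun x =>
  \sum_(k < f x) (2 ^ k.+1 <= (f x).+1))%N); last first.
  by apply: (recursive_sum (F := fun x k => (2 ^ k.+1 <= (f x).+1)%N)) => //;
     rec_auto.
move=> x; move: (f x) => n.
have count_lt L m : (\sum_(k < m) (k < L) = minn m L)%N.
  elim: m => [|m IH]; first by rewrite big_ord0 min0n.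
  by rewrite big_ord_recr /= IH; case: (ltnP m L); lia.
rewrite (eq_bigr (fun k : 'I_n => nat_of_bool (k < len n)%N)) => [|k _].
  by rewrite count_lt; apply/minn_idPr; exact: len_le.
congr nat_of_bool; apply/idP/idP => [|lt_k]; first exact: trunc_log_max.
apply: leq_trans (trunc_logP (isT : (1 < 2)%N) (ltn0Sn n)).
by rewrite leq_pexp2l.
Qed.

(** At stage k, the machine is run with bound k on the first k inputs. The best
    description found so far of the string number y gives a lower bound for its
    weight, here multiplied by 2 ^ k to make it an integer. *)
Definition weight_num (c : Defs.code) (k y : nat) : nat :=
  \max_(t < k) ((run c k t == y.+1) * 2 ^ (k - len t)).

Definition mass_num (c : Defs.code) (k : nat) (Y : pred nat) : nat :=
  \sum_(y < k) Y y * weight_num c k y.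

Lemma recursive_mass_num c k (Y : nat -> pred nat) : recursive k ->
  rec_decidable (fun z => Y (proj1 z) (proj2 z)) ->
  recursive (fun x => mass_num c (k x) (Y x)).
Proof.
move=> hk hY; apply: (recursive_sum
  (F := fun x y => (Y x y * weight_num c (k x) y)%N)) => //.
apply: recursive_mul => //; apply: (recursive_max (F := fun z t =>
  ((run c (k (proj1 z)) t == (proj2 z).+1) *
    2 ^ (k (proj1 z) - len t))%N)); rec_auto.
- by apply: recursive_run; rec_auto.
- by apply: recursive_len; rec_auto.
Qed.

Section Approximation.
Variables (R : realType) (U : seq bool -> option (seq bool)) (c : Defs.code).
Hypothesis Uc : forall t s,
  U t = Some s <-> computes set0 c (string_code t) (string_code s).
Hypothesis pfU : prefix_free [set t | U t != None].

Let w : nat -> R := string_weight R U.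
Let w_ge0 := string_weight_ge0 R U.
Let w_le1 N := sum_string_weight_le1 R N pfU.

Lemma weight_num_le k y : (weight_num c k y)%:R <= 2 ^+ k * w y.
Proof.
rewrite /weight_num; elim/big_ind: _ => [|a b ha hb|t _].
- by rewrite mulr_ge0 ?exprn_ge0.
- by rewrite /maxn; case: ifP.
case: eqP => [/run_sound|_]; last by rewrite mul0n mulr_ge0 ?exprn_ge0.
rewrite -{1}(string_ofK t) -{1}(string_ofK y) mul1n => /Uc /K_le[j Kj jt].
rewrite /w /string_weight Kj /=; have lt_k : (len t <= k)%N.
  exact: leq_trans (len_le t) (ltnW (ltn_ord t)).
have {}jt : (j <= len t)%N by rewrite -(string_ofK t) len_string_code.
rewrite natrX -exprB ?unitfE ?(leq_trans jt) //.
by rewrite ler_weXn2l ?ler1n // leq_sub2l.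
Qed.

Lemma weight_num_ge y :
  \forall k \near \oo, 2 ^+ k * w y <= (weight_num c k y)%:R.
Proof.
rewrite /w /string_weight; case E : K => [j|] /=; last first.
  by apply: nearW => k; rewrite mulr0.
have [t [tj /Uc]] := K_Some E; rewrite string_ofK => /run_complete ht.
near=> k.
have kt : (string_code t < k)%N by near: k; exact: nbhs_infty_gt.
have lt_k : (j <= k)%N.
  by rewrite -tj -len_string_code (leq_trans (len_le _)) // ltnW.
rewrite -exprB ?unitfE // -natrX ler_nat.
apply: leq_trans (leq_bigmax (Ordinal kt)) => /=.
by rewrite (near ht k) // eqxx mul1n len_string_code tj.
Unshelve. all: by end_near. Qed.

Lemma mass_num_le k (Y : pred nat) :
  (mass_num c k Y)%:R <= 2 ^+ k * mass w [set n | Y n].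
Proof.
apply: le_trans (ler_wpM2l _ (partial_le_mass w_ge0 w_le1 _ k)); last first.
  by rewrite exprn_ge0.
rewrite natr_sum mulr_sumr; apply: ler_sum => y _.
rewrite indicE; case: (boolP (Y y)) => [Yy|/negP Yy]; last first.
  by rewrite memNset // mul0n mul0r mulr0.
by rewrite mem_set // mul1n mul1r weight_num_le.
Qed.

Lemma lt_mass_num r (Y : pred nat) : r < mass w [set n | Y n] ->
  exists k, 2 ^+ k * r < (mass_num c k Y)%:R.
Proof.
move=> /(lt_mass_partial w_ge0 w_le1)[N ltr].
have H : \forall k \near \oo, forall y, (y < N)%N ->
    2 ^+ k * w y <= (weight_num c k y)%:R.
  by apply: near_forall_lt => y _; exact: weight_num_ge.
suff /filter_ex : \forall k \near \oo, 2 ^+ k * r < (mass_num c k Y)%:R by [].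
near=> k.
have Hk : forall y, (y < N)%N -> 2 ^+ k * w y <= (weight_num c k y)%:R.
  by near: k.
have Nk : (N <= k)%N by near: k; exact: nbhs_infty_ge.
apply: (@lt_le_trans _ _ (2 ^+ k * \sum_(n < N) \1_[set n | Y n] (n : nat) * w n)).
  by rewrite ltr_pM2l // exprn_gt0.
apply: (@le_trans _ _ (\sum_(y < N) Y y * weight_num c k y)%:R).
  rewrite natr_sum mulr_sumr; apply: ler_sum => y _.
  rewrite indicE; case: (boolP (Y y)) => [Yy|/negP Yy]; last first.
    by rewrite memNset // mul0n mul0r mulr0.
  by rewrite mem_set // mul1n mul1r Hk.
rewrite ler_nat /mass_num (big_ord_widen k (fun y => Y y * weight_num c k y)%N) //.
by rewrite big_mkcond leq_sum // => y _; case: ifP.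
Unshelve. all: by end_near. Qed.

End Approximation.

(** n codes a rational interval with end points a and b, and u codes a dyadic
    i / 2 ^ N with a stage k. The test says that the stage j approximation of
    mass (below i N) is at most a, and that the stage k approximation of
    mass (upto i N) is at least b, with denominators cleared.
    As in [in_gap], only one of the two is imposed at the ends 0 and 1. *)
Definition gap_test (c : Defs.code) (n u j : nat) : bool :=
  let: i := proj1 (proj1 u) in
  let: N := proj2 (proj1 u) in
  let: k := proj2 u in
  let: a := proj1 n in
  let: b := proj2 n in
  (((i == 0) ||
   (mass_num c j (fun y => numer y * 2 ^ N < i * 2 ^ len y)%N * (proj2 a).+1 +
      proj2 (proj1 a) * 2 ^ j <= proj1 (proj1 a) * 2 ^ j)) &&
  ((2 ^ N <= i) ||
   (proj1 (proj1 b) * 2 ^ k <= proj2 (proj1 b) * 2 ^ k +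
     mass_num c k (fun y => numer y * 2 ^ N <= i * 2 ^ len y)%N * (proj2 b).+1)))%N.

Lemma decidable_gap_test c : rec_decidable (fun z =>
  gap_test c (proj1 (proj1 z)) (proj2 (proj1 z)) (proj2 z)).
Proof.
have hnum f : recursive f -> recursive (fun x => numer (f x)).
  by move=> hf; rewrite /numer; rec_auto; exact: recursive_len.
rewrite /gap_test; rec_auto.
- apply: (@recursive_mass_num c _ (fun z y =>
    (numer y * 2 ^ proj2 (proj1 (proj2 (proj1 z)))
     < proj1 (proj1 (proj2 (proj1 z))) * 2 ^ len y)%N)); rec_auto.
  + by apply: hnum; rec_auto.
  + by apply: recursive_len; rec_auto.
- apply: (@recursive_mass_num c _ (fun z y =>
    (numer y * 2 ^ proj2 (proj1 (proj2 (proj1 z)))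
     <= proj1 (proj1 (proj2 (proj1 z))) * 2 ^ len y)%N)); rec_auto.
  + by apply: hnum; rec_auto.
  + by apply: recursive_len; rec_auto.
Qed.

(** * The image of f *)

Lemma rational_between (R : realType) (x y : R) : x < y ->
  exists n, x < Defs.rational R n < y.
Proof.
move=> /rat_in_itvoo[q]; rewrite in_itv /= => hq.
have [a [b E]] : exists a b : nat, numq q = a%:Z - b%:Z.
  by case: (numq q) => m; [exists m, 0%N|exists 0%N, m.+1]; lia.
exists (pair_nat (pair_nat a b) `|denq q|.-1); rewrite /Defs.rational.
rewrite !Cantor.cancel_of_to prednK ?absz_gt0 ?denq_neq0 //.
suff -> : (a%:R - b%:R) / `|denq q|%:R = ratr q :> R by [].
rewrite /ratr E rmorphB /=; congr (_ / _).
by rewrite -[in RHS](gez0_abs (ltW (denq_gt0 q))).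
Qed.

Lemma rational_le_nat (R : realType) (p k n : nat) :
  (p%:R <= 2 ^+ k * Defs.rational R n) =
  (p * (proj2 n).+1 + proj2 (proj1 n) * 2 ^ k <= proj1 (proj1 n) * 2 ^ k)%N.
Proof.
rewrite /Defs.rational; case: Cantor.of_nat => m d; case: Cantor.of_nat => i j /=.
rewrite mulrA ler_pdivlMr // -(ler_nat R) natrD !natrM !natrX mulrBr lerBrDr.
by rewrite [_ * i%:R]mulrC [_ * j%:R]mulrC.
Qed.

Lemma nat_le_rational (R : realType) (p k n : nat) :
  (2 ^+ k * Defs.rational R n <= p%:R) =
  (proj1 (proj1 n) * 2 ^ k <= proj2 (proj1 n) * 2 ^ k + p * (proj2 n).+1)%N.
Proof.
rewrite /Defs.rational; case: Cantor.of_nat => m d; case: Cantor.of_nat => i j /=.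
rewrite mulrA ler_pdivrMr // -(ler_nat R) natrD !natrM !natrX mulrBr lerBlDl.
by rewrite [_ * i%:R]mulrC [_ * j%:R]mulrC.
Qed.

Lemma Pi01_class_measurable (R : realType) A (P : set R) : Pi01_class A P ->
  measurable (P : set (measurableTypeR R)).
Proof.
move=> [W [_ ->]]; apply: measurableC; apply: bigcup_measurable => n _.
rewrite /rational_interval; case: Cantor.of_nat => a b.
rewrite (_ : [set r | _] = `]Defs.rational R a, Defs.rational R b[%classic).
  exact: measurable_itv.
by apply/seteqP; split=> r; rewrite /= in_itv.
Qed.

(** A rational interval is enumerated when it lies in a gap. Every point of a
    gap is in an enumerated interval: b can be chosen below an approximation of
    mass (upto i N) that exceeds the point, and a above mass (below i N). *)
Lemma range_value_Pi01 (R : realType) U c :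
  (forall t s, U t = Some s <->
     computes set0 c (string_code t) (string_code s)) ->
  prefix_free [set t | U t != None] ->
  Pi01_class halting_problem (range (value (string_weight R U))).
Proof.
move=> Uc pfU; set w := string_weight R U.
have w_ge0 := string_weight_ge0 R U : forall n, 0 <= w n.
have w_le1 := (fun N => sum_string_weight_le1 R N pfU) :
  forall N, \sum_(n < N) w n <= 1.
exists [set n | exists u, forall j, gap_test c n u j]; split.
  exact/ce_in_halting_problem/decidable_gap_test.
apply/seteqP; split=> [_ [x _ <-] [n [u hu]]|r hr].
  rewrite /rational_interval; case E : Cantor.of_nat => [a b] /andP[ar rb].
  apply: (value_not_in_gap w_ge0 w_le1 (x := x)
    (i := proj1 (proj1 u)) (N := proj2 (proj1 u))); split.
    have [->|i0] := eqVneq (proj1 (proj1 u)) 0%N; [by left|right].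
    apply: le_lt_trans ar; rewrite leNgt /below; apply/negP.
    move=> /(lt_mass_num Uc pfU)[j]; apply/negP; rewrite -leNgt rational_le_nat.
    by have := hu j; rewrite /gap_test E /= (negbTE i0) => /andP[].
  have [|i_lt] := leqP (2 ^ proj2 (proj1 u)) (proj1 (proj1 u)); [by left|right].
  apply: lt_le_trans rb _; rewrite -(ler_pM2l (exprn_gt0 (proj2 u) (ltr0n R 2))).
  rewrite /upto; apply: le_trans (mass_num_le R Uc pfU _ _).
  rewrite nat_le_rational.
  have := hu 0%N; rewrite /gap_test E /= => /andP[_].
  by rewrite leqNgt i_lt.
have [|/existsNP[i /existsNP[N /contrapT[hl hu]]]] :=
    pselect (forall i N, ~ in_gap w r i N).
  by move=> /(value_of_not_in_gap w_ge0 w_le1)[x <-]; exists x.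
have [a /andP[la ar]] : exists a, (if i == 0%N then r - 1 else mass w (below i N))
    < Defs.rational R a < r.
  apply: rational_between; case: eqP hl => [_ _|i0 [//|//]].
  by rewrite ltrBlDr ltrDl.
have [b [rb [k hb]]] : exists b, r < Defs.rational R b /\ exists k,
    (2 ^ N <= i)%N \/ 2 ^+ k * Defs.rational R b <=
      (mass_num c k (fun y => numer y * 2 ^ N <= i * 2 ^ len y)%N)%:R.
  case: hu => [Ni|/(lt_mass_num Uc pfU)[k ltr]].
    have [b /andP[rb _]] := rational_between (ltr_pwDr ltr01 (lexx r)).
    by exists b; split=> //; exists 0%N; left.
  have := ltr; rewrite mulrC -ltr_pdivlMr ?exprn_gt0 //.
  move=> /rational_between[b /andP[rb bk]]; exists b; split=> //.
  by exists k; right; rewrite mulrC -ler_pdivlMr ?exprn_gt0 // ltW.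
case: hr; exists (pair_nat a b); last first.
  by rewrite /rational_interval Cantor.cancel_of_to /= ar rb.
exists (pair_nat (pair_nat i N) k) => j; rewrite /gap_test !projE.
apply/andP; split; last first.
  by case: hb => [->//|hb]; rewrite -(nat_le_rational R) hb orbT.
case: eqP la => //= _ la; rewrite -(rational_le_nat R).
apply: le_trans (mass_num_le R Uc pfU j _) _.
by rewrite ler_pM2l ?exprn_gt0 // ltW.
Qed.

Theorem fact4p2 (R : realType) (U : seq bool -> option (seq bool))
    (hU : optimal U) :
  (forall x : nat -> bool, (0 <= left_weight R U x <= 1)%E) /\
  Pi01_class halting_problem (left_weight_image R U) /\
  (forall r : R, left_weight_image R U r -> ~ kurtz_random halting_problem r).
Proof.
have [[[c Uc] pfU] _] := hU.
have w_ge0 := string_weight_ge0 R U.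
have w_le1 := (fun N => sum_string_weight_le1 R N pfU).
have imE : left_weight_image R U = range (value (string_weight R U)).
  apply/seteqP; split=> [r [x]|_ [x _ <-]].
    by rewrite left_weight_value // => -[<-]; exists x.
  by exists x; rewrite left_weight_value.
have PiU := range_value_Pi01 R Uc pfU.
split=> [x|].
  by rewrite left_weight_value // !lee_fin mass_ge0 ?mass_le1.
rewrite imE; split=> // r Pr /(_ _ PiU); apply=> //.
by apply: range_value_measure0 => //; exact: Pi01_class_measurable PiU.
Qed.
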